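(* Let $\mathrm{Dis}$ be a linear disparity measure with weighting function $w_{\mathrm{Dis}}$. Suppose that for $a\in\{0,1\}$ both $\eta_a(X)$ and $w_{\mathrm{Dis}}(X,a)$ have probability density functions when $X\sim\mathbb P_{X\mid A=a}$, the boundary sets $\{x:\eta_a(x)=\frac12+\frac t2 w_{\mathrm{Dis}}(x,a)\}$, $t\in\mathbb R$, being of $\mathbb P_{X\mid A=a}$-measure zero. For $t\in\mathbb R$ let $f_{\mathrm{Dis},t}(x,a)=I\big(\eta_a(x)>\frac12+\frac t2 w_{\mathrm{Dis}}(x,a)\big)$ and $D_{\mathrm{Dis}}(t)=\mathrm{Dis}(f_{\mathrm{Dis},t})$; let $t_{\mathrm{Dis}}(0)=\operatorname{argmin}_t\{|t|:|D_{\mathrm{Dis}}(t)|\le0\}$, $\underline t_0=\min(0,t_{\mathrm{Dis}}(0))$ and $\overline t_0=\max(0,t_{\mathrm{Dis}}(0))$. Then the fair Pareto frontier $\mathrm{FPF}$ includes all classifiers $f_{\mathrm{Dis},t}$ for $t\in[\underline t_0,\overline t_0]$: $$\{f_{\mathrm{Dis},t}:t\in[\underline t_0,\overline t_0]\}\subset\mathrm{FPF}.$$ Moreover, for any $f_{\mathrm{FPF}}\in\mathrm{FPF}$ there is $t\in[\underline t_0,\overline t_0]$ such that $$R(f_{\mathrm{Dis},t})=R(f_{\mathrm{FPF}})\quad\text{and}\quad\mathrm{Dis}(f_{\mathrm{Dis},t})=\mathrm{Dis}(f_{\mathrm{FPF}}).$$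
   Context: Let $(X,A,Y)\sim\mathbb P$ be a random triple with values in $\mathcal X\times\{0,1\}\times\{0,1\}$, $p_a=\mathbb P(A=a)>0$, $\eta_a(x)=\mathbb P(Y=1\mid A=a,X=x)$, and $\mathbb P_{X\mid A=a}$ the conditional law of $X$ given $A=a$. $I(\cdot)$ is the indicator function. A (randomized) classifier is a measurable $f:\mathcal X\times\{0,1\}\to[0,1]$; $\mathcal F$ is the set of all of them. Its prediction satisfies $\widehat Y_f\mid X=x,A=a\sim\mathrm{Bernoulli}(f(x,a))$, conditionally independent of $Y$ given $(X,A)$. The misclassification error is $R(f)=\mathbb P(Y\ne\widehat Y_f)$. A disparity measure $\mathrm{Dis}:\mathcal F\to[-1,1]$ is linear if there is a weighting function $w_{\mathrm{Dis}}:\mathcal X\times\{0,1\}\to\mathbb R$ (depending on $\mathbb P$) such that for all $f\in\mathcal F$, $\mathrm{Dis}(f)=\int f(x,a)\,w_{\mathrm{Dis}}(x,a)\,d\mathbb P_{X,A}(x,a)$. A classifier $f_1$ Pareto-dominates $f_2$ if either $R(f_1)<R(f_2)$ and $|\mathrm{Dis}(f_1)|\le|\mathrm{Dis}(f_2)|$, or $R(f_1)\le R(f_2)$ and $|\mathrm{Dis}(f_1)|<|\mathrm{Dis}(f_2)|$. A classifier is Pareto optimal if no classifier in $\mathcal F$ dominates it; the fair Pareto frontier $\mathrm{FPF}$ is the set of all Pareto optimal classifiers. *)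

(* Defs.v *)
From HB Require Import structures.
From mathcomp Require Import all_boot all_order all_algebra.
From mathcomp Require Import all_classical all_reals all_analysis.

Set Implicit Arguments.
Unset Strict Implicit.
Unset Printing Implicit Defensive.

Import Order.TTheory GRing.Theory Num.Theory.
Import numFieldNormedType.Exports.

Local Open Scope classical_set_scope.
Local Open Scope ring_scope.

HB.instance Definition _ (d1 d2 : measure_display) (T1 : measurableType d1)
    (T2 : measurableType d2) :=
  isMeasurableFun.Build _ _ (T1 * T2)%type T1 fst measurable_fst.

Section fair_classification.
Context (d : measure_display) (T : measurableType d) (R : realType).

(* P is the law of the triple (X, A, Y): the random variables are the
   coordinates X z = z.1.1, A z = z.1.2 and Y z = z.2, and (X, A) is fst. *)
Implicit Types (P : probability (T * bool * bool)%type R).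
Implicit Types (f eta w : T * bool -> R) (Dis : (T * bool -> R) -> R).

Definition law_XA P := distribution P fst.

Definition law_X_given P (a : bool) : set T -> \bar R := fun B =>
  (fine (P [set z | B z.1.1 /\ z.1.2 = a]) / fine (P [set z | z.1.2 = a]))%:E.

(* eta (x, a) is a version of P(Y = 1 | X = x, A = a). *)
Definition regression_function P eta : Prop :=
  [/\ measurable_fun [set: T * bool] eta,
      forall xa, 0 <= eta xa <= 1 &
      forall C, measurable C ->
        P [set z | C z.1 /\ z.2 = true] =
        (\int[law_XA P]_(xa in C) (eta xa)%:E)%E].

Definition classifier : set (T * bool -> R) :=
  [set f : T * bool -> R | measurable_fun [set: T * bool] f /\ forall xa, 0 <= f xa <= 1].

(* Joint law of ((X, A, Y), Yhat_f): given (X, A, Y) = z the prediction is drawn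
   from Bernoulli(f(X, A)), which depends on z through (X, A) only; hence the
   conditional independence of Yhat_f and Y given (X, A). *)
Definition prediction_law P f : set (T * bool * bool * bool) -> \bar R :=
  kproduct_snd (fun _ : unit => P : {measure set _ -> \bar R})
    (fun z => bernoulli_prob (f z.1)) tt.

(* P(Yhat_f = b | X, A, Y) = P(Yhat_f = b | X, A) = bernoulli_pmf (f (X, A)) b. *)
Lemma prediction_lawE P f (C : set (T * bool * bool)) (b : bool) :
  classifier f ->
  prediction_law P f (C `*` [set b]) =
  (\int[P]_(z in C) (bernoulli_pmf (f z.1) b)%:E)%E.
Proof.
move=> [mf f01]; rewrite /prediction_law /kproduct_snd /kproduct.
rewrite [RHS]integral_mkcond; apply: eq_integral => z _.
rewrite /kernel.intker_indic /= integral_bernoulli_prob//.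
have zE c : ((z, c) \in C `*` [set b]) = (z \in C) && (c == b).
  apply/idP/idP; first by rewrite inE => -[/= Cz ->]; rewrite eqxx mem_set.
  by move=> /andP[]; rewrite !inE => Cz /eqP ->.
rewrite !indicE patchE !zE.
by case: (z \in C); case: b {zE}; rewrite /= ?mule1 ?mule0 ?adde0 ?add0e.
Qed.

Definition misclassification_error P f : \bar R :=
  prediction_law P f [set u | u.1.2 <> u.2].

Definition disparity_measure Dis : Prop :=
  forall f, classifier f -> -1 <= Dis f <= 1.

(* The equation is between extended reals, so it also asserts that the integral
   is finite, for every classifier f. *)
Definition weighting_function P Dis w : Prop :=
  measurable_fun [set: T * bool] w /\
  forall f, classifier f ->
    (Dis f)%:E = (\int[law_XA P]_xa (f xa * w xa)%:E)%E.

Definition pareto_dominates P Dis f1 f2 : Prop :=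
  ((misclassification_error P f1 < misclassification_error P f2)%E /\
    `|Dis f1| <= `|Dis f2|) \/
  ((misclassification_error P f1 <= misclassification_error P f2)%E /\
    `|Dis f1| < `|Dis f2|).

Definition fair_pareto_frontier P Dis : set (T * bool -> R) :=
  [set f | classifier f /\
    ~ exists2 g, classifier g & pareto_dominates P Dis g f].

Definition has_density (mu : set R -> \bar R) : Prop :=
  exists g : R -> R, [/\ measurable_fun [set: R] g, forall y, 0 <= g y &
    forall B : set R, measurable B ->
      mu B = (\int[lebesgue_measure]_(y in B) (g y)%:E)%E].

Definition threshold_classifier eta w (t : R) : T * bool -> R :=
  \1_[set xa | eta xa > 2^-1 + t / 2 * w xa].

Definition is_argmin_abs (S : set R) (t : R) : Prop :=
  S t /\ forall s, S s -> `|t| <= `|s|.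

End fair_classification.

(* Main.v *)
Require Import Defs.
From mathcomp Require Import all_boot all_order all_algebra.
From mathcomp Require Import all_classical all_reals all_analysis.
From mathcomp Require Import measurable_realfun ring lra.

Import Order.TTheory GRing.Theory Num.Theory.
Import numFieldNormedType.Exports.

Local Open Scope classical_set_scope.
Local Open Scope ring_scope.

(* The risk is R(f) = E[eta] + E[f (1 - 2 eta)], so the threshold classifier f_t
   minimises the Lagrangian R(f) + t Dis(f) over all classifiers. Adding the
   optimality inequalities of f_s and f_t shows that t |-> Dis(f_t) is
   nonincreasing, and it is continuous because the boundary sets are null. For t
   between 0 and t0 the sign of t agrees with that of Dis(f_t), and Lagrangian
   optimality turns into Pareto optimality. Conversely a Pareto optimal f has
   |Dis(f)| <= |Dis(f_0)|, so by the intermediate value theorem some f_t attains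
   |Dis(f)| up to the sign of t0; its risk is then that of f. At t = 0 the
   Lagrangian ignores the disparity and one uses instead that f_0 is the almost
   surely unique risk minimiser. *)

(** * Pareto optimality of Lagrangian minimisers, for an abstract risk [r] and disparity [D] *)

Definition dominates {R : realType} {F : Type} (r D : F -> R) (g f : F) : Prop :=
  (r g < r f /\ `|D g| <= `|D f|) \/ (r g <= r f /\ `|D g| < `|D f|).

(** The sign condition [0 <= t0] makes [D (th t)] nonnegative on the segment. As [t >= 0] there,
    [t * D f] is at most [t * |D f|], with equality at [th t], so the Lagrangian inequality survives
    with absolute disparities, the quantities that domination compares. *)
Lemma lagrangian_frontier_ge0 (R : realType) (F : Type) (C : set F)
    (r D : F -> R) (th : R -> F) (t0 : R) :
  (forall t, C (th t)) ->
  (forall t f, C f -> r (th t) + t * D (th t) <= r f + t * D f) ->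
  (forall f, C f -> r f = r (th 0) -> D f = D (th 0)) ->
  continuous (D \o th) -> D (th t0) = 0 -> 0 <= t0 ->
  (forall t, 0 <= t <= t0 -> forall g, C g -> ~ dominates r D g (th t)) /\
  (forall f, C f -> (forall g, C g -> ~ dominates r D g f) ->
    exists t, [/\ 0 <= t <= t0, r (th t) = r f & D (th t) = D f]).
Proof.
move=> Cth Lmin Luniq Dcont D0 t0_ge0.
have Dmono s t : s < t -> D (th t) <= D (th s).
  move=> st; have := Lmin s _ (Cth t); have := Lmin t _ (Cth s) => h1 h2.
  have : (t - s) * (D (th t) - D (th s)) <= 0 by lra.
  by rewrite pmulr_rle0 ?subr_gt0// subr_le0.
have Dge0 t : t <= t0 -> 0 <= D (th t).
  by rewrite le_eqVlt => /predU1P[->|/Dmono]; rewrite D0.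
split=> [t /andP[t_ge0 tt0] g Cg gdom|f Cf fopt].
  have Dt := Dge0 t tt0; have gt := Lmin t g Cg.
  have Dg := ler_norm (D g).
  have tDg := ler_wpM2l t_ge0 Dg.
  case: gdom => -[]; rewrite (ger0_norm Dt) => rg dg.
    by have := ler_wpM2l t_ge0 dg; lra.
  (* Here only the disparity is strictly smaller, and strictness survives multiplication by [t] only
     when [t > 0]. At [t = 0] the risks must coincide, and [Luniq] then forces equal disparities. *)
  move: t_ge0; rewrite le_eqVlt => /predU1P[t_eq0|t_gt0].
    subst t; have : r g = r (th 0) by lra.
    by move/(Luniq _ Cg) => E; move: dg; rewrite -E; lra.
  by have := dg; rewrite -(ltr_pM2l t_gt0); lra.
have r0 : r (th 0) <= r f by have := Lmin 0 f Cf; lra.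
(* Otherwise [th 0], whose risk is minimal, would dominate [f]. *)
have Df0 : `|D f| <= D (th 0).
  rewrite leNgt; apply/negP => lt0; apply: (fopt _ (Cth 0)); right.
  by rewrite (ger0_norm (Dge0 0 t0_ge0)).
(* The target value is [|D f|], which lies between [D (th t0) = 0] and [D (th 0)]; the sign of [D f]
   is settled only at the end. *)
have [||t + Dt] := @IVT R (D \o th) 0 t0 `|D f| t0_ge0.
- by apply: continuous_subspaceT.
- by rewrite /= D0 ge_min le_max Df0 normr_ge0 orbT.
rewrite in_itv/= => t0t0; exists t.
have /andP[t_ge0 tt0] := t0t0; move: Dt => /= Dt.
have Lt := Lmin t f Cf.
have tDf := ler_wpM2l t_ge0 (ler_norm (D f)).
(* The Lagrangian inequality gives [r (th t) <= r f] because [t * D f <= t * D (th t)]; a strict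
   inequality would let [th t] dominate [f]. *)
have rE : r (th t) = r f.
  apply/eqP; rewrite eq_le; apply/andP; split; first by rewrite Dt in Lt; lra.
  rewrite leNgt; apply/negP => lt_r; apply: (fopt _ (Cth t)); left.
  by rewrite Dt normr_id.
split => //; move: t_ge0; rewrite le_eqVlt => /predU1P[t_eq0|t_gt0].
  by subst t; rewrite -(Luniq _ Cf).
(* With equal risks, the Lagrangian inequality reads [t * D (th t) <= t * D f]. Dividing by [t > 0]
   gives [|D f| <= D f], which excludes a negative disparity. *)
apply/eqP; rewrite eq_le; apply/andP; split; last by rewrite Dt ler_norm.
by rewrite -(ler_pM2l t_gt0); lra.
Qed.

(** A negative [t0] is handled by the reflection that replaces [D] by its opposite and [th t] by
    [th (- t)]: the Lagrangian keeps its form, and domination sees only [|D|]. *)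
Lemma lagrangian_frontier (R : realType) (F : Type) (C : set F)
    (r D : F -> R) (th : R -> F) (t0 : R) :
  (forall t, C (th t)) ->
  (forall t f, C f -> r (th t) + t * D (th t) <= r f + t * D f) ->
  (forall f, C f -> r f = r (th 0) -> D f = D (th 0)) ->
  continuous (D \o th) -> D (th t0) = 0 ->
  (forall t, t \in `[Num.min 0 t0, Num.max 0 t0] ->
    forall g, C g -> ~ dominates r D g (th t)) /\
  (forall f, C f -> (forall g, C g -> ~ dominates r D g f) ->
    exists t, [/\ t \in `[Num.min 0 t0, Num.max 0 t0],
      r (th t) = r f & D (th t) = D f]).
Proof.
move=> Cth Lmin Luniq Dcont D0; have [t0_ge0|t0_lt0] := leP 0 t0.
  have [H1 H2] :=
    @lagrangian_frontier_ge0 R F C r D th t0 Cth Lmin Luniq Dcont D0 t0_ge0.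
  split=> [t|f Cf fopt]; first by rewrite in_itv/=; exact: H1.
  by have [t [tt0 rt Dt]] := H2 f Cf fopt; exists t; rewrite in_itv.
have domE g f : dominates r (fun f => - D f) g f <-> dominates r D g f.
  by rewrite /dominates !normrN.
have [||||||H1 H2] := @lagrangian_frontier_ge0 R F C r (fun f => - D f)
    (fun t => th (- t)) (- t0).
- by move=> t; exact: Cth.
- by move=> t f Cf; have := Lmin (- t) f Cf; rewrite !mulrN !mulNr.
- by move=> f Cf; rewrite oppr0 => /(Luniq _ Cf) ->.
- move=> t; apply: continuousN.
  apply: (@continuous_comp _ _ _ -%R (D \o th)); first exact: opp_continuous.
  exact: Dcont.
- by rewrite opprK D0 oppr0.
- by rewrite oppr_ge0 ltW.
split=> [t|f Cf fopt].
  rewrite in_itv/= => /andP[t0t t_le0] g Cg gdom.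
  have := H1 (- t); rewrite opprK oppr_ge0 lerN2 t_le0 t0t => /(_ isT g Cg).
  by apply; apply/domE.
have [g Cg /domE|t [tt0 rt /oppr_inj Dt]] := H2 f Cf; first exact: fopt.
by exists (- t); rewrite in_itv/= lerNr lerNl oppr0 andbC.
Qed.

(** * Integration against densities, and the risk as an integral over the law of (X, A) *)

Lemma ge0_integral_density (d : measure_display) (T : measurableType d)
    (R : realType) (mu : {sigma_finite_measure set T -> \bar R})
    (nu : {measure set T -> \bar R}) (q h : T -> \bar R) :
  (nu [set: T] < +oo)%E -> measurable_fun [set: T] q -> measurable_fun [set: T] h ->
  (forall x, 0 <= q x)%E -> (forall x, 0 <= h x)%E ->
  (forall C, measurable C -> nu C = \int[mu]_(x in C) q x)%E ->
  (\int[nu]_x h x = \int[mu]_x (h x * q x))%E.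
Proof.
move=> nu_fin mq mh q0 h0 nuE.
(* Restricting [nu] to the whole space changes no value but packages it as a finite measure, so that
   its Radon-Nikodym derivative is available. *)
pose nu' : {finite_measure set T -> \bar R} := mfrestr measurableT nu_fin.
have nu'E C : nu' C = nu C by rewrite /nu' /= /mfrestr /mrestr setIT.
have numu : nu' `<< mu.
  apply/null_content_dominatesP => C mC muC0.
  by rewrite nu'E nuE// null_set_integral//; exact: measurable_funTS.
transitivity (\int[nu']_x h x)%E.
  by apply: eq_measure_integral => C mC _; rewrite -[LHS]nu'E.
rewrite -(Radon_Nikodym_SigmaFinite.change_of_variables numu)//.
set g := Radon_Nikodym_SigmaFinite.f nu' mu.
have gint : mu.-integrable setT g by exact: Radon_Nikodym_SigmaFinite.f_integrable.
have mg := measurable_int _ gint.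
apply: ae_eq_integral => //; try exact: emeasurable_funM.
(* The derivative and [q] have the same integral, [nu E], over every measurable [E], so they agree
   almost everywhere. *)
have : ae_eq mu setT g q.
  apply: integral_ae_eq => // E _ mE.
  by rewrite -nuE// -nu'E -Radon_Nikodym_SigmaFinite.f_integral.
by apply: filterS => x /= gq _; rewrite gq.
Qed.

Section risk.
Context {d : measure_display} {T : measurableType d} {R : realType}.
Variable P : probability (T * bool * bool)%type R.
Variable eta : T * bool -> R.
Hypothesis heta : regression_function P eta.

Let measurable_label (b : bool) :
  measurable [set z : T * bool * bool | z.2 = b].
Proof.
rewrite (_ : [set _ | _] = setT `&` snd @^-1` [set b]); last by rewrite setTI.
exact: measurable_snd.
Qed.

Definition label_prob (b : bool) (xa : T * bool) : R :=
  if b then eta xa else 1 - eta xa.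

Lemma label_prob_ge0 b xa : 0 <= label_prob b xa.
Proof. by case: heta => _ /(_ xa) /andP[? ?] _; case: b; rewrite /= ?subr_ge0. Qed.

Lemma measurable_label_prob b : measurable_fun setT (label_prob b).
Proof. by case: heta => meta _ _; case: b => //=; exact: measurable_funB. Qed.

(** For the label [true] this is the defining property of [eta]. For [false], the sum over both
    labels is the mass of [C] on either side, and the finite [true] term cancels. *)
Lemma label_probE b C : measurable C ->
  (P [set z | C z.1 /\ z.2 = b] = \int[law_XA P]_(xa in C) (label_prob b xa)%:E)%E.
Proof.
case: heta => meta eta01 etaE mC; case: b => /=; first exact: etaE.
have mC1 : measurable (fst @^-1` C : set (T * bool * bool)).
  by rewrite -[X in measurable X]setTI; exact: measurable_fst.
have mCb b : measurable [set z : T * bool * bool | C z.1 /\ z.2 = b].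
  exact: measurableI mC1 (measurable_label b).
have PC : (P [set z | C z.1 /\ z.2 = false] + P [set z | C z.1 /\ z.2 = true] =
    \int[law_XA P]_(xa in C) (label_prob false xa)%:E +
    \int[law_XA P]_(xa in C) (label_prob true xa)%:E)%E.
  rewrite -measureU; first last.
  - by apply/seteqP; split => z // [[/= _ ->] []].
  - exact: mCb.
  - exact: mCb.
  rewrite -ge0_integralD//; first last.
  - by apply/measurable_EFinP; apply: measurable_funTS; exact: measurable_label_prob.
  - by move=> xa _; rewrite lee_fin label_prob_ge0.
  - by apply/measurable_EFinP; apply: measurable_funTS; exact: measurable_label_prob.
  - by move=> xa _; rewrite lee_fin label_prob_ge0.
  under eq_integral do rewrite -EFinD /= subrK.
  rewrite integral_cst// mul1e /law_XA /distribution /pushforward.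
  congr (P _); apply/seteqP; split => z /=; first by case=> -[].
  by move=> Cz; case: z.2; [right|left].
move: PC; rewrite (etaE _ mC).
have fin : (\int[law_XA P]_(xa in C) (label_prob true xa)%:E)%E \is a fin_num.
  by rewrite /= -etaE// fin_num_measure.
by move/(congr1 (fun x => x - \int[law_XA P]_(xa in C) (label_prob true xa)%:E)%E);
  rewrite !addeK.
Qed.

(** Restrict [P] to the event that the label is [b], then push it forward to (X, A). The restriction
    has an indicator as density, and by [label_probE] its image has density [label_prob b] with
    respect to [law_XA P]; [ge0_integral_density] applies to both. *)
Lemma ge0_integral_label b (h : T * bool -> \bar R) :
  measurable_fun [set: T * bool] h -> (forall xa, 0 <= h xa)%E ->
  (\int[P]_(z in [set z | z.2 = b]) h z.1 =
   \int[law_XA P]_xa (h xa * (label_prob b xa)%:E))%E.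
Proof.
move=> mh h0; set E := [set z | z.2 = b].
have mE : measurable E := measurable_label b.
have mh1 : measurable_fun [set: T * bool * bool] (fun z => h z.1).
  exact: measurableT_comp.
have PE_fin : (mrestr P mE [set: T * bool * bool] < +oo)%E.
  by rewrite /mrestr setTI (le_lt_trans (probability_le1 P mE))// ltry.
transitivity (\int[mrestr P mE]_z h z.1)%E.
  rewrite (@ge0_integral_density _ _ _ P _ (EFin \o \1_E))//; first last.
  - by move=> C mC; rewrite integral_indic// setIC.
  - by move=> z; rewrite lee_fin.
  - exact/measurable_EFinP/measurable_indic.
  by rewrite integral_mkcond; apply: eq_integral => z _ /=; rewrite epatch_indic.
transitivity (\int[pushforward (mrestr P mE) fst]_xa h xa)%E.
  by rewrite ge0_integral_pushforward.
apply: ge0_integral_density => //.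
- by apply/measurable_EFinP; exact: measurable_label_prob.
- by move=> xa; rewrite lee_fin label_prob_ge0.
- by move=> C mC; rewrite -label_probE.
Qed.

(** Once the Bernoulli draw is integrated out, an error has probability [1 - f] on label [true] and
    [f] on label [false]. Weighting by the label probabilities gives
    [(1 - f) * eta + f * (1 - eta)], which is the stated integrand. *)
Lemma misclassification_errorE f : classifier f ->
  misclassification_error P f =
    (\int[law_XA P]_xa (eta xa + f xa * (1 - 2 * eta xa))%:E)%E.
Proof.
move=> [mf f01].
have f0 xa : 0 <= f xa by have /andP[] := f01 xa.
have f1 xa : 0 <= 1 - f xa by have /andP[] := f01 xa; rewrite subr_ge0.
have mf1 : measurable_fun [set: T * bool] (fun xa => 1 - f xa).
  exact: measurable_funB.
have err : misclassification_error P f =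
    (\int[P]_z (if z.2 then 1 - f z.1 else f z.1)%:E)%E.
  rewrite /misclassification_error /prediction_law /kproduct_snd /kproduct.
  apply: eq_integral => z _; rewrite /kernel.intker_indic /=.
  rewrite integral_bernoulli_prob//.
  rewrite !indicE; case: z => xa [] /=.
    by rewrite memNset ?mem_set//= mule0 mule1 add0e.
  by rewrite mem_set// memNset//= mule0 mule1 adde0.
have -> : misclassification_error P f =
   (\int[P]_(z in [set z | z.2 = true]) (1 - f z.1)%:E +
    \int[P]_(z in [set z | z.2 = false]) (f z.1)%:E)%E.
  rewrite err.
  have -> : [set: T * bool * bool] = [set z | z.2 = true] `|` [set z | z.2 = false].
    by apply/seteqP; split => // -[xa []] _; [left|right].
  rewrite ge0_integral_setU//; first last.
  - by apply/disj_setPS => z [/= ->].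
  - by move=> z _; case: ifPn; rewrite lee_fin.
  - apply/measurable_EFinP; apply: measurable_funTS; apply: measurable_fun_ifT => //.
    + exact: measurableT_comp mf1 _.
    + exact: measurableT_comp mf _.
  by congr (_ + _)%E; apply: eq_integral => z /[1!inE] /= ->.
rewrite (@ge0_integral_label true (fun xa => (1 - f xa)%:E))//; last first.
  exact/measurable_EFinP.
rewrite (@ge0_integral_label false (EFin \o f))//; last exact/measurable_EFinP.
rewrite -ge0_integralD//.
- by apply: eq_integral => xa _; rewrite -!EFinM -EFinD; congr EFin => /=; ring.
- by move=> xa _; rewrite mule_ge0// lee_fin// label_prob_ge0.
- by apply: emeasurable_funM; apply/measurable_EFinP => //; exact: measurable_label_prob.
- by move=> xa _; rewrite mule_ge0// lee_fin// label_prob_ge0.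
- by apply: emeasurable_funM; apply/measurable_EFinP => //; exact: measurable_label_prob.
Qed.

End risk.

(** For classifiers the error is finite by [misclassification_error_fin_num], so [fine] loses
    nothing and the Lagrangian can be formed in [R]. *)
Definition risk {d : measure_display} {T : measurableType d} {R : realType}
    (P : probability (T * bool * bool)%type R) (f : T * bool -> R) : R :=
  fine (misclassification_error P f).

Definition decision_boundary {T : Type} {R : realType} (eta w : T * bool -> R)
    (t : R) : set (T * bool) :=
  [set xa | eta xa = 2^-1 + t / 2 * w xa].

(** * Threshold classifiers: Lagrangian optimality, uniqueness at zero, continuity of the
    disparity *)

Section disparity.
Context {d : measure_display} {T : measurableType d} {R : realType}.
Variable P : probability (T * bool * bool)%type R.
Variable eta : T * bool -> R.
Hypothesis heta : regression_function P eta.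
Variables (Dis : (T * bool -> R) -> R) (w : T * bool -> R).
Hypothesis hw : weighting_function P Dis w.

Let measurable_eta : measurable_fun [set: T * bool] eta.
Proof. by case: heta. Qed.

Let measurable_w : measurable_fun [set: T * bool] w.
Proof. by case: hw. Qed.

Local Notation boundary := (decision_boundary eta w).

Let measurable_cut t : measurable_fun [set: T * bool] (fun xa => 2^-1 + t / 2 * w xa).
Proof. by apply: measurable_funD => //; exact: measurable_funM. Qed.

Lemma measurable_decision_boundary t : measurable (boundary t).
Proof.
rewrite (_ : boundary t =
  setT `&` (fun xa => eta xa == 2^-1 + t / 2 * w xa) @^-1` [set true]).
  by apply: measurable_fun_eqr => //; exact: measurable_cut.
by apply/seteqP; split=> [xa /eqP|xa /= [_] /eqP].
Qed.

Lemma threshold_classifierE t xa : threshold_classifier eta w t xa =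
  (2^-1 + t / 2 * w xa < eta xa)%R%:R.
Proof.
rewrite /threshold_classifier indicE; congr (nat_of_bool _)%:R.
by apply/idP/idP; rewrite inE.
Qed.

Lemma threshold_classifierP t : classifier (threshold_classifier eta w t).
Proof.
split=> [|xa]; last by rewrite threshold_classifierE; case: ltP; rewrite ?lexx ler01.
apply: measurable_indic.
rewrite (_ : [set xa | _] =
  setT `&` (fun xa => 2^-1 + t / 2 * w xa < eta xa) @^-1` [set true]).
  by apply: measurable_fun_ltr => //; exact: measurable_cut.
by rewrite setTI; apply/seteqP; split.
Qed.

(* The constant classifier 1 has a finite disparity, which is the integral of w. *)
Lemma integrable_weight : (law_XA P).-integrable setT (EFin \o w).
Proof.
have c1 : classifier (cst 1 : T * bool -> R) by split => // xa; rewrite /= ler01 lexx.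
apply/integrableP; split; first exact/measurable_EFinP.
rewrite integral_fin_num_abs//.
case: hw => _ /(_ _ c1) /=; under eq_integral do rewrite mul1r.
by move=> <-.
Qed.

Lemma integrable_classifierM f : classifier f ->
  (law_XA P).-integrable setT (EFin \o (fun xa => f xa * w xa)).
Proof.
move=> [mf f01]; apply: le_integrable integrable_weight => //.
  by apply/measurable_EFinP; exact: measurable_funM.
move=> xa _; have /andP[f0 f1] := f01 xa.
by rewrite /= lee_fin normrM (ger0_norm f0) ler_piMl.
Qed.

Lemma disparityE f : classifier f -> Dis f = \int[law_XA P]_xa (f xa * w xa).
Proof. by move=> cf; case: hw => _ /(_ _ cf) /(congr1 fine). Qed.

Let loss f xa := eta xa + f xa * (1 - 2 * eta xa).

Let integrable_loss f : classifier f ->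
  (law_XA P).-integrable setT (EFin \o loss f).
Proof.
move=> [mf f01]; apply: measurable_bounded_integrable => //.
- by rewrite (le_lt_trans (probability_le1 _ _))// ltry.
- by apply: measurable_funD => //; apply: measurable_funM => //;
    apply: measurable_funB => //; exact: measurable_funM.
(* The loss is the convex combination [(1 - f) * eta + f * (1 - eta)] of numbers in the unit
   interval, hence the bound 1. *)
exists 1; split; rewrite ?num_real// => y y1 xa _ /=.
case: heta => _ /(_ xa) /andP[e0 e1] _; have /andP[f0 f1] := f01 xa.
by apply: le_trans (ltW y1); rewrite ler_norml /loss; nra.
Qed.

Let lossE f : classifier f ->
  misclassification_error P f = (\int[law_XA P]_xa loss f xa)%:E.
Proof.
move=> cf; rewrite (misclassification_errorE P eta heta _ cf) /Rintegral fineK//.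
by apply: integrable_fin_num => //; exact: integrable_loss.
Qed.

Lemma misclassification_error_fin_num f : classifier f ->
  misclassification_error P f \is a fin_num.
Proof. by move=> cf; rewrite lossE. Qed.

Let riskE f : classifier f -> risk P f = \int[law_XA P]_xa loss f xa.
Proof. by move=> cf; rewrite /risk lossE. Qed.

(** The part of the integrand that depends on [f] is [2 * f * (2^-1 + t / 2 * w - eta)]. Over values
    of [f] in the unit interval it is least at 1 when the bracket is negative and at 0 otherwise,
    which explains the cut in [threshold_classifier]. *)
Let loss_threshold t f xa : 0 <= f xa <= 1 ->
  let th := threshold_classifier eta w t in
  loss th xa + t * (th xa * w xa) <= loss f xa + t * (f xa * w xa).
Proof.
by move=> /andP[f0 f1]; rewrite /= /loss threshold_classifierE; case: ltP => /= h; nra.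
Qed.

Lemma threshold_classifier_lagrangian t f : classifier f ->
  risk P (threshold_classifier eta w t) + t * Dis (threshold_classifier eta w t)
  <= risk P f + t * Dis f.
Proof.
have lagE g : classifier g ->
    (law_XA P).-integrable setT
      (EFin \o (fun xa => loss g xa + t * (g xa * w xa))) /\
    risk P g + t * Dis g = \int[law_XA P]_xa (loss g xa + t * (g xa * w xa)).
  move=> cg; have gw := integrable_classifierM _ cg.
  have tgw : (law_XA P).-integrable setT (EFin \o (fun xa => t * (g xa * w xa))).
    rewrite (_ : _ \o _ = (fun xa => t%:E * (g xa * w xa)%:E)%E) //.
    exact: integrableZl.
  split; first exact: integrableD (integrable_loss _ cg) tgw.
  rewrite RintegralD//; last exact: integrable_loss.
  by rewrite RintegralZl// riskE// disparityE.
move=> cf; have ct := threshold_classifierP t.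
have [it et] := lagE _ ct; have [jf ef] := lagE _ cf.
rewrite [leLHS]et [leRHS]ef {et ef}.
by apply: le_Rintegral => // xa _; apply: loss_threshold; case: cf.
Qed.

Hypothesis boundary0 : forall t, law_XA P (boundary t) = 0%E.

(** At [t = 0] the loss of [f] exceeds that of the threshold classifier pointwise, so equal risks
    make the difference vanish almost everywhere. This difference is [(f - th) * (1 - 2 * eta)], and
    off the null boundary [eta] is not one half, so [f] and [th] agree almost everywhere. *)
Lemma risk_minimizer_disparity f : classifier f ->
  risk P f = risk P (threshold_classifier eta w 0) ->
  Dis f = Dis (threshold_classifier eta w 0).
Proof.
set th := threshold_classifier eta w 0 => cf rE.
have cth : classifier th by exact: threshold_classifierP.
have mf := cf.1; have mth := cth.1.
have mloss g : classifier g -> measurable_fun [set: T * bool] (loss g).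
  by move=> cg; apply/measurable_EFinP; exact: measurable_int (integrable_loss _ cg).
have loss_ge0 xa : 0 <= loss f xa - loss th xa.
  have := @loss_threshold 0 f xa (cf.2 xa); rewrite /= !mul0r !addr0.
  by rewrite subr_ge0.
have {rE} int0 : \int[law_XA P]_xa (loss f xa - loss th xa) = 0.
  rewrite RintegralB; [|by []|exact: integrable_loss..].
  by rewrite -(riskE _ cf) -(riskE _ cth) rE subrr.
have : (\int[law_XA P]_xa `|(loss f xa - loss th xa)%:E| = 0)%E.
  transitivity (\int[law_XA P]_xa (loss f xa - loss th xa)%:E)%E.
    by apply: eq_integral => xa _; rewrite gee0_abs// lee_fin loss_ge0.
  rewrite -[LHS]fineK; first exact: (congr1 EFin int0).
  apply: integrable_fin_num => //.
  exact: integrableB (integrable_loss _ cf) (integrable_loss _ cth).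
move/ae_eq_integral_abs => /(_ measurableT).
have mB : measurable_fun [set: T * bool] (fun xa => (loss f xa - loss th xa)%:E).
  by apply/measurable_EFinP; apply: measurable_funB; exact: mloss.
move/(_ mB) => loss0.
rewrite !disparityE// /Rintegral; congr fine; apply: ae_eq_integral => //.
- by apply/measurable_EFinP; exact: measurable_funM.
- by apply/measurable_EFinP; exact: measurable_funM.
have bdry : {ae law_XA P, forall xa, ~ boundary 0 xa}.
  exists (boundary 0); split; [exact: measurable_decision_boundary|exact: boundary0|].
    by move=> xa /contrapT.
apply: filterS2 loss0 bdry => xa /(_ I) [] l0 nb _; congr (_ * _)%:E; move: l0.
have : eta xa != 2^-1.
  by apply/eqP => e; apply: nb; rewrite /decision_boundary /= !mul0r addr0.
have /andP[f0 f1] := cf.2 xa.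
rewrite /loss /th threshold_classifierE !mul0r addr0; case: ltgtP => //= h _ l0.
  have : (1 - f xa) * (2 * eta xa - 1) = 0 by lra.
  by move=> /eqP; rewrite mulf_eq0 => /orP[] /eqP; lra.
have : f xa * (2 * eta xa - 1) = 0 by lra.
by move=> /eqP; rewrite mulf_eq0 => /orP[] /eqP; lra.
Qed.

(** Dominated convergence along sequences, with the integrable bound [|w|]. Off the null boundary at
    [t], [eta] lies strictly on one side of the cut; it stays there for parameters near [t], so the
    integrands are eventually constant at each such point. *)
Lemma continuous_threshold_disparity :
  continuous (Dis \o threshold_classifier eta w).
Proof.
move=> t; apply/(@cvg_nbhsP R R^o) => u ut /=.
set th := threshold_classifier eta w.
have cth s : classifier (th s) by exact: threshold_classifierP.
have mthw s : measurable_fun [set: T * bool] (fun xa => (th s xa * w xa)%:E).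
  by apply/measurable_EFinP; apply: measurable_funM => //; exact: (cth s).1.
have DisE s : (Dis (th s))%:E = (\int[law_XA P]_xa (th s xa * w xa)%:E)%E.
  by case: hw => _ ->.
suff : (Dis (th (u n)))%:E @[n --> \oo] --> (Dis (th t))%:E.
  by move=> /fine_cvg.
rewrite DisE; under eq_fun do rewrite DisE.
have [] // := @dominated_convergence _ _ _ (law_XA P) setT measurableT
  (fun n xa => (th (u n) xa * w xa)%:E) (fun xa => (th t xa * w xa)%:E)
  (fun xa => `|w xa|%:E).
- have : {ae law_XA P, forall xa, ~ boundary t xa}.
    exists (boundary t); split; [exact: measurable_decision_boundary|exact: boundary0|].
    by move=> xa /contrapT.
  apply: filterS => xa nb _; apply: cvg_near_cst.
  have cut : 2^-1 + u n / 2 * w xa @[n --> \oo] --> 2^-1 + t / 2 * w xa.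
    by apply: cvgD; [exact: cvg_cst|apply: cvgMl; apply: cvgMl].
  have : eta xa != 2^-1 + t / 2 * w xa by exact/eqP.
  rewrite neq_lt => /orP[lt_eta|lt_eta].
    apply: filterS (cvgr_gt _ cut _ lt_eta) => n hn.
    by rewrite /th !threshold_classifierE !ltNge !ltW.
  apply: filterS (cvgr_lt _ cut _ lt_eta) => n hn.
  by rewrite /th !threshold_classifierE hn lt_eta.
- exact: integrable_abse integrable_weight.
- apply: aeW => xa n _; have /andP[h0 h1] := (cth (u n)).2 xa.
  by rewrite lee_fin normrM (ger0_norm h0) ler_piMl.
Qed.

End disparity.

(** * From conditional to joint null sets, and the theorem *)

Lemma law_XA_null {d : measure_display} {T : measurableType d} {R : realType}
    (P : probability (T * bool * bool)%type R) (B : set (T * bool)) :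
  (forall a : bool, (0 < P [set z | z.1.2 = a])%E) -> measurable B ->
  (forall a : bool, law_X_given P a [set x | B (x, a)] = 0%E) ->
  law_XA P B = 0%E.
Proof.
move=> hA mB null.
have mB1 : measurable (fst @^-1` B : set (T * bool * bool)).
  by rewrite -[X in measurable X]setTI; exact: measurable_fst.
have mA a : measurable [set z : T * bool * bool | z.1.2 = a].
  rewrite (_ : [set _ | _] = setT `&` (snd \o fst) @^-1` [set a]); last by rewrite setTI.
  by apply: measurableT_comp => //; exact: measurable_snd.
have setE a : [set z : T * bool * bool | B (z.1.1, a) /\ z.1.2 = a] =
    fst @^-1` B `&` [set z | z.1.2 = a].
  by apply/seteqP; split=> -[[x b] y] /= [Bx ba]; split => //; move: Bx; rewrite ba.
have mBa a : measurable [set z : T * bool * bool | B (z.1.1, a) /\ z.1.2 = a].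
  by rewrite setE; exact: measurableI.
have PB a : P [set z | B (z.1.1, a) /\ z.1.2 = a] = 0%E.
  (* The ratio vanishes through its numerator or, since [0^-1 = 0], through its denominator; [hA]
     excludes the latter. *)
  have /eqP := null a; rewrite /law_X_given eqe mulf_eq0 invr_eq0.
  case/orP => /eqP fine0; first by rewrite -[LHS]fineK ?fin_num_measure// fine0.
  by have := hA a; rewrite -[X in (_ < X)%E]fineK ?fin_num_measure// fine0 ltxx.
rewrite /law_XA /distribution /pushforward.
have -> : fst @^-1` B =
    [set z : T * bool * bool | B (z.1.1, true) /\ z.1.2 = true] `|`
    [set z | B (z.1.1, false) /\ z.1.2 = false].
  apply/seteqP; split=> -[[x b] y] /=; last by case=> -[Bx ->].
  by case: b => Bx; [left|right].
by apply: null_set_setU; [exact: mBa|exact: mBa|exact: PB|exact: PB].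
Qed.

(** Both errors are finite, so comparing them as extended reals amounts to comparing their real
    values; this carries the abstract frontier result over to [pareto_dominates]. *)
Lemma pareto_dominatesE {d : measure_display} {T : measurableType d} {R : realType}
    (P : probability (T * bool * bool)%type R) (eta : T * bool -> R)
    (Dis : (T * bool -> R) -> R) (f g : T * bool -> R) :
  regression_function P eta -> classifier f -> classifier g ->
  pareto_dominates P Dis g f <->
  dominates (risk P) Dis g f.
Proof.
move=> heta cf cg; rewrite /pareto_dominates /dominates /risk.
have ff := misclassification_error_fin_num P eta heta _ cf.
have fg := misclassification_error_fin_num P eta heta _ cg.
by rewrite -(fineK ff) -(fineK fg) lte_fin lee_fin.
Qed.

Theorem proposition4p4 (d : measure_display) (T : measurableType d)
  (R : realType) (P : probability (T * bool * bool)%type R)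
  (hA : forall a : bool, (0 < P [set z | z.1.2 = a])%E)
  (eta : T * bool -> R) (heta : regression_function P eta)
  (Dis : (T * bool -> R) -> R) (hDis : disparity_measure Dis)
  (w : T * bool -> R) (hw : weighting_function P Dis w)
  (heta_pdf : forall a : bool,
    has_density (pushforward (law_X_given P a) (fun x => eta (x, a))))
  (hw_pdf : forall a : bool,
    has_density (pushforward (law_X_given P a) (fun x => w (x, a))))
  (hboundary : forall (a : bool) (t : R),
    law_X_given P a [set x | eta (x, a) = 2^-1 + t / 2 * w (x, a)] = 0%E)
  (t0 : R)
  (ht0 : is_argmin_abs
    [set t | `|Dis (threshold_classifier eta w t)| <= 0] t0) :
  [set threshold_classifier eta w t
    | t in `[Num.min 0 t0, Num.max 0 t0]] `<=` fair_pareto_frontier P Dis /\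
  forall f, fair_pareto_frontier P Dis f ->
    exists t, [/\ t \in `[Num.min 0 t0, Num.max 0 t0],
      misclassification_error P (threshold_classifier eta w t) =
      misclassification_error P f &
      Dis (threshold_classifier eta w t) = Dis f].
Proof.
(* The null boundaries of the two groups combine into a null set of the joint law, the form that
   uniqueness and continuity rely on. *)
have boundary0 t : law_XA P (decision_boundary eta w t) = 0%E.
  apply: law_XA_null => //; last by move=> a; exact: hboundary.
  exact: (measurable_decision_boundary P eta heta Dis w hw).
have cth := threshold_classifierP P eta heta Dis w hw.
have err_fin := misclassification_error_fin_num P eta heta.
have [|||||opt reach] := @lagrangian_frontier R _ (@classifier d T R)
  (risk P) Dis (threshold_classifier eta w) t0.
- exact: cth.
- exact: (threshold_classifier_lagrangian P eta heta Dis w hw).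
- exact: (risk_minimizer_disparity P eta heta Dis w hw boundary0).
- exact: (continuous_threshold_disparity P eta heta Dis w hw boundary0).
- by have [/=] := ht0; rewrite normr_le0 => /eqP.
split=> [_ [t tt0 <-]|f [cf fopt]].
  split; first exact: cth.
  move=> [g cg /(pareto_dominatesE P eta _ _ _ heta (cth t) cg)].
  exact: opt.
have [g cg /(pareto_dominatesE P eta _ _ _ heta cf cg) gf|t [tt0 rt Dt]] :=
    reach f cf.
  by apply: fopt; exists g.
exists t; split; [exact: tt0| |exact: Dt].
rewrite -(fineK (err_fin _ (cth t))) -(fineK (err_fin _ cf)).
exact: (congr1 EFin rt).
Qed.
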